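(* Let $n\ge1$ and let $G=\mathrm{PSL}(2,2^n)$ act on the $13$-subsets of $X=\mathrm{GF}(2^n)\cup\{\infty\}$. Then \[m_{429}=\begin{cases}\dfrac{2^n(2^n-4)(2^n-10)}{576} & \text{if } n \text{ is even},\\[2mm] \dfrac{(2^n-2)(2^n-4)(2^n-8)}{576} & \text{if } n\text{ is odd}.\end{cases}\]
   Context: $\mathrm{PSL}(2,2^n)$ is the group of all maps $X\to X$, $x\mapsto\frac{ax+b}{cx+d}$ with $a,b,c,d\in\mathrm{GF}(2^n)$, $ad-bc\neq0$ (usual conventions for $\infty$). For a $13$-subset $B$ of $X$, $G_B=\{g\in G: g(B)=B\}$ and $G(B)=\{g(B):g\in G\}$. Each orbit $G(B)$ is a simple $3$-$(2^n+1,13,\lambda_B)$ design (every $3$-subset of $X$ lies in exactly $\lambda_B$ members of $G(B)$), with $\lambda_B=1716/|G_B|$. $m_\lambda$ denotes the number of $G$-orbits $G(B)$ of $13$-subsets with $\lambda_B=\lambda$; so $m_{429}$ counts the orbits with $|G_B|=4$. *)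

(* Defs.v *)
From mathcomp Require Import all_boot all_order all_algebra all_fingroup.
From mathcomp Require Import ring.
Set Implicit Arguments.
Unset Strict Implicit.
Unset Printing Implicit Defensive.
Import GRing.Theory.
Local Open Scope ring_scope.

Section Mobius.

Variable F : finFieldType.

(* The projective line is [option F], with [None] the point at infinity. *)
Definition mobius (a b c d : F) (x : option F) : option F :=
  match x with
  | Some z =>
      if c * z + d == 0 then None else Some ((a * z + b) / (c * z + d))
  | None => if c == 0 then None else Some (a / c)
  end.

(* All fractional linear maps with nonzero determinant (each is a permutation,
   see [mobius_in_PSL2]). In general this is PGL(2, F); it coincides with
   PSL(2, F) when F has characteristic 2, since every element of F is then a
   square. *)
Definition PSL2 : {set {perm option F}} :=
  [set g : {perm option F} |
    [exists a : F, exists b : F, exists c : F, exists d : F,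
      (a * d - b * c != 0) && [forall x, g x == mobius a b c d x]]].

Lemma PSL2P (g : {perm option F}) :
  reflect (exists a b c d : F, a * d - b * c != 0 /\ g =1 mobius a b c d)
          (g \in PSL2).
Proof.
rewrite inE; apply: (iffP existsP) => [[a]|[a [b [c [d [D E]]]]]].
  case/existsP=> b /existsP[c /existsP[d /andP[D /forallP E]]].
  by exists a, b, c, d; split=> // x; apply/eqP.
exists a; apply/existsP; exists b; apply/existsP; exists c.
by apply/existsP; exists d; rewrite D; apply/forallP=> x; rewrite E.
Qed.

Lemma mobius1 x : mobius 1 0 0 1 x = x.
Proof. by case: x => [z|] /=; rewrite ?eqxx // mul0r add0r oner_eq0 mul1r addr0 divr1. Qed.

Lemma mobius_comp (a b c d a' b' c' d' : F) x :
  a * d - b * c != 0 -> a' * d' - b' * c' != 0 ->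
  mobius a' b' c' d' (mobius a b c d x) =
  mobius (a' * a + b' * c) (a' * b + b' * d)
         (c' * a + d' * c) (c' * b + d' * d) x.
Proof.
move=> D D'; case: x => [z|] /=.
- have E : (c' * a + d' * c) * z + (c' * b + d' * d) =
           c' * (a * z + b) + d' * (c * z + d) by ring.
  rewrite E; have [h|h] := eqVneq (c * z + d) 0 => /=.
    have N : a * z + b != 0.
      apply: contraNneq D => h'.
      have [z0|z0] := eqVneq c 0.
        have d0 : d = 0 by rewrite -h z0; ring.
        by rewrite z0 d0; apply/eqP; ring.
      have : c * (a * d - b * c) = 0.
        have -> : c * (a * d - b * c) =
          c * (a * (c * z + d) - c * (a * z + b)) by ring.
        by rewrite h h'; ring.
      by move/eqP; rewrite mulf_eq0 (negPf z0).
    rewrite h mulr0 addr0 mulf_eq0 (negPf N) orbF.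
    case: eqVneq => // c0; congr Some.
    have -> : (a' * a + b' * c) * z + (a' * b + b' * d) =
              a' * (a * z + b) + b' * (c * z + d) by ring.
    by rewrite h; field; rewrite N c0.
  have -> : c' * ((a * z + b) / (c * z + d)) + d' =
            (c' * (a * z + b) + d' * (c * z + d)) / (c * z + d) by field.
  rewrite mulf_eq0 invr_eq0 (negPf h) orbF.
  by case: eqVneq => // k; congr Some; field; rewrite k h.
have [h|h] := eqVneq c 0 => /=.
  have a0 : a != 0 by apply: contraNneq D => ->; rewrite h; apply/eqP; ring.
  rewrite h !mulr0 !addr0 mulf_eq0 (negPf a0) orbF.
  by case: eqVneq => // k; congr Some; field; rewrite k a0.
have -> : c' * (a / c) + d' = (c' * a + d' * c) / c by field.
rewrite mulf_eq0 invr_eq0 (negPf h) orbF.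
by case: eqVneq => // k; congr Some; field; rewrite k h.
Qed.

Lemma mobius_inj (a b c d : F) :
  a * d - b * c != 0 -> injective (mobius a b c d).
Proof.
set D := a * d - b * c => D0.
have D1 : (d / D) * (a / D) - (- b / D) * (- c / D) != 0.
  have -> : (d / D) * (a / D) - (- b / D) * (- c / D) = D^-1.
    have -> : (d / D) * (a / D) - (- b / D) * (- c / D) = D / D / D.
      by rewrite {5}/D; ring.
    by rewrite divff // mul1r.
  by rewrite invr_eq0.
apply: (can_inj (g := mobius (d / D) (- b / D) (- c / D) (a / D))) => x.
rewrite mobius_comp // -[RHS]mobius1; congr mobius.
- by rewrite -(divff D0) {3}/D; ring.
- by ring.
- by ring.
- by rewrite -(divff D0) {3}/D; ring.
Qed.

Lemma mobius_in_PSL2 (a b c d : F) (D : a * d - b * c != 0) :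
  perm (mobius_inj D) \in PSL2.
Proof. by apply/PSL2P; exists a, b, c, d; split=> // x; rewrite permE. Qed.

Lemma PSL2_group_set : group_set PSL2.
Proof.
apply/group_setP; split.
  apply/PSL2P; exists 1, 0, 0, 1; split=> [|x]; last by rewrite perm1 mobius1.
  by rewrite mulr1 mulr0 subr0 oner_eq0.
move=> g h /PSL2P[a [b [c [d [D E]]]]] /PSL2P[a' [b' [c' [d' [D' E']]]]].
apply/PSL2P; exists (a' * a + b' * c), (a' * b + b' * d),
  (c' * a + d' * c), (c' * b + d' * d); split.
  have -> : (a' * a + b' * c) * (c' * b + d' * d) -
            (a' * b + b' * d) * (c' * a + d' * c) =
            (a' * d' - b' * c') * (a * d - b * c) by ring.
  by rewrite mulf_neq0.
by move=> x; rewrite permM E E' mobius_comp.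
Qed.

Canonical PSL2_group := Group PSL2_group_set.

End Mobius.

(* A simple t-(v, k, lambda) design on the point set X: no repeated blocks. *)
Definition is_design (X : finType) (t v k lambda : nat) (D : {set {set X}}) :
    bool :=
  [&& #|X| == v,
      [forall B in D, #|B| == k] &
      [forall T : {set X},
        (#|T| == t) ==> (#|[set B in D | T \subset B]| == lambda)]].

(* ['P^*] is the induced action g(B) = {g x | x in B} on subsets. *)
Definition PSL2_orbits (F : finFieldType) (k : nat) :
    {set {set {set option F}}} :=
  [set orbit ('P^*)%act (PSL2 F) B | B : {set option F} & #|B| == k].

(* [m F lambda] counts the orbits G(B) of 13-subsets with lambda_B = lambda;
   lambda_B is the design index, not the derived value 1716 / |G_B|. *)
Definition m (F : finFieldType) (lambda : nat) : nat :=
  #|[set D in PSL2_orbits F 13 | is_design 3 #|F|.+1 13 lambda D]|.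

(* Main.v *)
Require Import Defs.
From mathcomp Require Import all_boot all_order all_algebra all_fingroup.
From mathcomp Require Import all_solvable all_field ring zify.
Set Implicit Arguments.
Unset Strict Implicit.
Unset Printing Implicit Defensive.
Import GRing.Theory.
Local Open Scope ring_scope.

(** Write [q] for the order [2 ^ n] of the field [F], [G] for the group and, for
    a 13-subset [B], [G_B] for its stabiliser in [G].

    As [G] is sharply 3-transitive, every orbit [G(B)] is a 3-design, and double
    counting of incident (triple, block) pairs gives [lambda_B * #|G_B| = 1716]
    ([is_design_orbit]). So [m F 429] is the number of orbits on the set of [B]
    with [#|G_B| = 4], and [#|G| = (q + 1) * q * (q - 1)] turns the problem into
    counting such [B] ([m429E]).

    A nontrivial 2-subgroup of [G] fixes exactly one point, because it fixes at
    most two and their number is odd. If [#|G_B| = 4], that point lies in [B],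
    since [#|B|] is odd; by transitivity it may be taken to be infinity, at the
    cost of a factor [q + 1] ([card_stab4_sets]). Then [B] is infinity together
    with a 12-subset [A] of [F], and the elements of [G_B] fixing infinity are
    the maps [x |-> a * x + b] preserving [A]. The converse is the crucial point
    ([card_stab4]): if exactly four affine maps preserve [A], nothing else in
    [G] preserves [B]. Indeed the four maps act regularly off infinity, so the
    orbit of infinity under [G_B] has a size in {1, 5, 9, 13}; and the last three
    sizes are impossible. An element of order 5 would fix at least three points of
    [B]; 36 elements would act faithfully on the 4 points off the orbit; and a
    normal subgroup of order 13 would contain a nontrivial element centralised by
    an involution, which would have to fix the same point as the involution.

    It remains to count the 12-subsets [A] of [F] with exactly four affine
    symmetries. These four are translations, since [q - 1] is odd. Let [T] be the
    translation stabiliser of [A]; its order divides both 12 and [q], so it is 1,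
    2 or 4.
    - The sets with [#|T| = 4] are the unions of three cosets of a subgroup of
      order 4: there are [(q - 1) * (q - 2) / 6 * 'C(q / 4, 3)] of them
      ([count_shift_stab4]).
    - Among these, the sets with an affine symmetry of multiplier [a != 1] have
      to be discarded. Multiplication by [a] permutes the three nonzero elements
      of [T] without fixed points, so [a ^+ 2 + a + 1 = 0]. For [n] odd there is
      no such [a]. For [n] even [A] is a regular orbit of a group of order 12,
      generated by a rotation of order 3 and by the translations by a line over
      the field with four elements, and there are [q * (q - 1) * (q - 4) / 144]
      such sets ([count_rotation]). *)

(** * Counting along the fibres of a function *)

Lemma card_fibres (T U : finType) (f : T -> U) (D : {set T}) (k : nat) :
  {in D, forall x, #|[set y in D | f y == f x]| = k} ->
  #|D| = (#|f @: D| * k)%N.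
Proof.
move=> fib; rewrite -sum1_card (partition_big_imset f) /=.
rewrite -sum_nat_const; apply: eq_bigr => _ /imsetP[x Dx ->].
by rewrite sum1dep_card -(fib x Dx); apply: eq_card => y; rewrite !inE.
Qed.

(** A saturated subset of [D] is the preimage of its image, so the saturated
    subsets made of [j] fibres correspond to the [j]-subsets of the image. It
    counts the unions of [j] classes of equal size without naming the quotient. *)
Lemma card_saturated (T U : finType) (f : T -> U) (D : {set T}) (k j : nat) :
  (0 < k)%N -> {in D, forall x, #|[set y in D | f y == f x]| = k} ->
  #|[set A : {set T} | [&& A \subset D, #|A| == (j * k)%N &
      [forall x in A, forall y in D, (f y == f x) ==> (y \in A)]]]|
    = 'C(#|f @: D|, j).
Proof.
move=> k_gt0 fib; rewrite -cards_draws.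
pose g (W : {set U}) := [set y in D | f y \in W].
have gE (W : {set U}) : W \subset f @: D -> f @: g W = W.
  move=> sW; apply/setP=> u; apply/imsetP/idP=> [[y + ->]|Wu].
    by rewrite inE => /andP[].
  have /imsetP[x Dx ux] := subsetP sW _ Wu.
  by exists x; rewrite // inE Dx -ux.
have cg (W : {set U}) : W \subset f @: D -> #|g W| = (#|W| * k)%N.
  move=> sW; rewrite -{2}(gE W sW); apply: card_fibres => x.
  rewrite inE => /andP[Dx Wx]; rewrite -(fib x Dx); apply: eq_card => y.
  by rewrite !inE; case: eqP => [->|]; rewrite ?andbF // Wx !andbT.
rewrite -(card_in_imset (f := g)) => [|W W' /[!inE] /andP[sW _] /andP[sW' _] e].
  apply: eq_card => A; rewrite inE; apply/and3P/imsetP.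
    case=> sA /eqP cA /forall_inP satA.
    have gA : g (f @: A) = A.
      apply/setP=> y; rewrite inE; apply/andP/idP=> [[Dy /imsetP[x Ax e]]|Ay].
        have /forall_inP/(_ y Dy) := satA x Ax.
        by move/implyP; apply; apply/eqP.
      by rewrite (subsetP sA) // imset_f.
    have sfA : f @: A \subset f @: D by exact: imsetS.
    exists (f @: A); last by rewrite gA.
    rewrite inE sfA /=; have := cg _ sfA; rewrite gA cA => /eqP.
    by rewrite eqn_pmul2r // eq_sym.
  case=> W /[!inE] /andP[sW /eqP cW] ->; split.
  - by apply/subsetP=> y; rewrite inE => /andP[].
  - by rewrite cg // cW.
  apply/forall_inP=> x; rewrite inE => /andP[_ Wx].
  by apply/forall_inP=> y Dy; apply/implyP=> /eqP e; rewrite inE Dy e.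
by rewrite -(gE W sW) -(gE W' sW') e.
Qed.

(** When [V] is a Klein four-group with neutral element [x0], these are its ordered
    generating pairs. *)
Lemma card_distinct_pairs (T : finType) (V : {set T}) (x0 : T) : x0 \in V ->
  #|[set p : T * T | [&& p.1 \in V, p.2 \in V, p.1 != x0, p.2 != x0 & p.1 != p.2]]|
  = (#|V|.-1 * #|V|.-2)%N.
Proof.
move=> V0.
rewrite -sum1dep_card (eq_bigl (fun p : T * T => (p.1 \in V :\ x0) &&
   (p.2 \in V :\ x0 :\ p.1))) => [|[v w]] /=; last first.
  rewrite !inE /=; case: (v \in V); case: (w \in V); rewrite ?andbF //= ?andbT.
  by rewrite (eq_sym w v) (andbC (v != w)).
rewrite -(pair_big_dep (fun v => v \in V :\ x0)
   (fun v w => w \in V :\ x0 :\ v) (fun _ _ => 1%N)) /=.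
have c1 : #|V :\ x0| = #|V|.-1 by rewrite [in RHS](cardsD1 x0) V0.
rewrite -c1 -sum_nat_const; apply: eq_bigr => v Vv.
by rewrite sum1_card [in RHS](cardsD1 v) Vv.
Qed.

Lemma bin3 k : ('C(k.+1, 3) * 6 = k.+1 * (k.-1 * k))%N.
Proof.
rewrite -[6%N]/(3`!)%N bin_ffact; case: k => [|k] //.
by rewrite !ffactnS ffactn0 muln1 /= (mulnC k).
Qed.

(** As a polynomial identity over the rationals, where the truncations of natural
    subtraction are harmless: the product vanishes at [k = 0, 1, 2]. *)
Lemma natr_bin3 (k : nat) :
  ('C(k, 3))%:R = k%:R * (k%:R - 1) * (k%:R - 2) / 6 :> rat.
Proof.
case: k => [|[|k]]; try by rewrite bin_small // ?subrr !(mulr0, mul0r).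
apply: (canRL (mulfK _)) => //.
have /(congr1 (fun i => i%:R : rat)) := bin3 k.+1; rewrite !natrM /= => ->.
by rewrite -[k.+2]addn2 -[k.+1]addn1 !natrD; ring.
Qed.

Lemma dvdn_semireg (aT : finGroupType) (rT : finType) (to : {action aT &-> rT})
    (H : {group aT}) (S : {set rT}) :
  [acts H, on S | to] -> {in S, forall x, 'C_H[x | to] = 1}%g -> (#|H| %| #|S|)%N.
Proof.
move=> actS free; rewrite (card_uniform_partition (n := #|H|) _ (orbit_partition actS)).
  exact: dvdn_mull.
by move=> _ /imsetP[x Sx ->]; rewrite card_orbit free // indexg1.
Qed.

(** * Translations preserving a 12-subset of the field *)

Section Translations.
Variable F : finFieldType.
Hypothesis char2 : 2%N \in [pchar F].
Let addxx (x : F) : x + x = 0 := addrr_pchar2 char2 x.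
Let oppx (x : F) : - x = x := oppr_pchar2 char2 x.
Let addxK (x y : F) : x + y + y = x.
Proof. by rewrite -addrA addxx addr0. Qed.
Let addKx (x y : F) : x + (x + y) = y.
Proof. by rewrite addrA addxx add0r. Qed.

Definition shift_stab (A : {set F}) : {set F} :=
  [set v | [forall x, (x + v \in A) == (x \in A)]].

(** The map [x |-> a * x + b] is encoded by the pair [(a, b)]. *)
Definition affine_stab (A : {set F}) : {set F * F} :=
  [set ab | (ab.1 != 0) && [forall x, (ab.1 * x + ab.2 \in A) == (x \in A)]].

Lemma shift_stabP (A : {set F}) v :
  reflect (forall x, (x + v \in A) = (x \in A)) (v \in shift_stab A).
Proof.
by rewrite inE; apply: (iffP forallP) => h x; apply/eqP; rewrite h.
Qed.

Lemma affine_stabP (A : {set F}) a b :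
  reflect (a != 0 /\ forall x, (a * x + b \in A) = (x \in A))
          ((a, b) \in affine_stab A).
Proof.
rewrite inE /=; case: eqP => /= h; first by constructor; case.
by apply: (iffP forallP) => [h' | [_ h'] x]; first split=> // x;
   apply/eqP; rewrite h'.
Qed.

Lemma affine_stab1 (A : {set F}) b : ((1, b) \in affine_stab A) = (b \in shift_stab A).
Proof.
apply/affine_stabP/shift_stabP => [[_ h] x|h]; first by rewrite -{1}(mul1r x).
by split=> [|x]; rewrite ?oner_eq0 // mul1r.
Qed.

(** In characteristic 2 closure under opposites is automatic, so these are the
    additive subgroups of [F]. *)
Definition is_addsub (V : {set F}) :=
  (0 \in V) /\ forall u v, u \in V -> v \in V -> u + v \in V.

Lemma shift_stab_addsub (A : {set F}) : is_addsub (shift_stab A).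
Proof.
split=> [|u v /shift_stabP hu /shift_stabP hv]; apply/shift_stabP=> x.
  by rewrite addr0.
by rewrite addrA hv hu.
Qed.

(** [fun x => [set z | x + z \in V]] is the quotient map modulo [V], restricted to
    a union [D] of cosets; its fibres are the cosets of [V] in [D]. *)
Lemma card_coset (V D : {set F}) x :
    is_addsub V -> (forall y v, y \in D -> v \in V -> y + v \in D) -> x \in D ->
  #|[set y in D | [set z | y + z \in V] == [set z | x + z \in V]]| = #|V|.
Proof.
case=> V0 VD DV Dx; rewrite -[RHS](card_imset _ (addrI x)); apply: eq_card => y.
rewrite inE; apply/andP/imsetP => [[Dy /eqP/setP/(_ y)]|[u Vu ->]].
  by rewrite !inE addxx V0 => /esym Vxy; exists (x + y); rewrite // addKx.
split; first exact: DV.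
apply/eqP/setP=> z; rewrite !inE; apply/idP/idP=> h.
  by have := VD _ _ Vu h; congr (_ \in V); rewrite (addrC x u) -(addrA u x z) addKx.
by rewrite addrAC; apply: VD.
Qed.

Lemma dvdn_addsub (V D : {set F}) :
  is_addsub V -> (forall y v, y \in D -> v \in V -> y + v \in D) ->
  (#|V| %| #|D|)%N.
Proof.
move=> hV hD; rewrite (card_fibres (fun x Dx => card_coset hV hD Dx)).
exact: dvdn_mull.
Qed.

(** The set [A] and the whole field are both unions of cosets of the stabiliser,
    so its order divides 12 and [2 ^ n]. *)
Lemma card_shift_stab (A : {set F}) (n : nat) : #|F| = (2 ^ n)%N -> #|A| = 12%N ->
  #|shift_stab A| \in [:: 1; 2; 4]%N.
Proof.
move=> cF cA; have hT := shift_stab_addsub A.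
have d1 : (#|shift_stab A| %| 12)%N.
  by rewrite -cA; apply: dvdn_addsub => // y v Ay /shift_stabP ->.
have d2 : (#|shift_stab A| %| 2 ^ n)%N.
  by rewrite -cF -cardsT; apply: dvdn_addsub => // *; rewrite inE.
have /(dvdn_pfactor _ _ (isT : prime 2)) [e _ eE] := d2; move: d1; rewrite eE.
case: e {eE} => [|[|[|e]]] // d.
have : (2 ^ 3 %| 12)%N by apply: dvdn_trans d; exact: dvdn_exp2l.
by [].
Qed.

Lemma card_klein (v w : F) : v != 0 -> w != 0 -> v != w ->
  #|[set 0; v; w; v + w]| = 4%N.
Proof.
move=> v0 w0 vw.
rewrite -!setUA !cardsU1 cards1 !inE !negb_or (eq_sym 0 v) (eq_sym 0 w).
have -> : (v == v + w) = false.
  by apply: contraNF w0 => /eqP e; rewrite -(addKx v w) -e addxx.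
have -> : (w == v + w) = false.
  by apply: contraNF v0 => /eqP e; rewrite -(addxK v w) -e addxx.
by rewrite (eq_sym 0 (v + w)) addr_eq0 oppx v0 w0 vw.
Qed.

(** [(t - 1) * (t - 2)] vanishes at [t = 1, 2] and is 6 at [t = 4]: counting the
    sets [A] together with such a pair singles out those with four translations. *)
Lemma card_shift_stab_pairs (n : nat) (A : {set F}) :
    #|F| = (2 ^ n)%N -> #|A| = 12%N ->
  #|[set p : F * F | [&& p.1 \in shift_stab A, p.2 \in shift_stab A,
      p.1 != 0, p.2 != 0 & p.1 != p.2]]| = (6 * (#|shift_stab A| == 4))%N.
Proof.
move=> cF cA; rewrite card_distinct_pairs; last by case: (shift_stab_addsub A).
by have := card_shift_stab cF cA; rewrite !inE => /or3P[] /eqP->.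
Qed.

(** An invariant 12-subset is a union of three of the [#|F| / 4] cosets of the
    subgroup generated by [v] and [w]. *)
Lemma card_shift_invariant v w : v != 0 -> w != 0 -> v != w ->
  #|[set A : {set F} | [&& #|A| == 12, v \in shift_stab A & w \in shift_stab A]]|
    = 'C(#|F| %/ 4, 3).
Proof.
move=> v0 w0 vw; pose V : {set F} := [set 0; v; w; v + w].
have hV : is_addsub V.
  split=> [|x y]; first by rewrite !inE eqxx.
  by rewrite !inE -!orbA => /or4P[] /eqP-> /or4P[] /eqP->;
    rewrite ?add0r ?addr0 ?addxx ?eqxx ?orbT // ?addxK ?addKx ?(addrAC v w v)
      ?addxx ?add0r ?(addrC w v) ?addxK ?addKx ?(addrCA w v w) ?addxx ?addr0
      ?eqxx ?orbT.
have cV : #|V| = 4%N by exact: card_klein.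
have VP u : u \in V -> [\/ u = 0, u = v, u = w | u = v + w].
  rewrite !inE -!orbA => /or4P[] /eqP->;
    by [constructor 1|constructor 2|constructor 3|constructor 4].
have [Vv Vw] : v \in V /\ w \in V by rewrite !inE !eqxx !orbT.
clearbody V.
pose f x := [set z | x + z \in V].
have fib : {in [set: F], forall x, #|[set y in [set: F] | f y == f x]| = 4%N}.
  by move=> x _; rewrite -cV; apply: card_coset => //= *; rewrite inE.
have -> : (#|F| %/ 4 = #|f @: [set: F]|)%N.
  by rewrite -cardsT (card_fibres fib) mulnK.
rewrite -(card_saturated 3 (isT : 0 < 4)%N fib); apply: eq_card => A.
rewrite [LHS]in_set [RHS]in_set subsetT; case: eqP => //= cA.
apply/andP/forall_inP => [[+ +] x Ax|h].
  move=> /shift_stabP hv /shift_stabP hw.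
  apply/forall_inP=> y _; apply/implyP=> /eqP/setP/(_ y).
  rewrite inE addxx (proj1 hV) inE => /esym hxy.
  rewrite -(addKx x y); case: (VP _ hxy) => ->;
    by rewrite ?addr0 ?addrA ?hw ?hv.
have AV x u : u \in V -> x \in A -> x + u \in A.
  move=> Vu Ax; have /forall_inP/(_ (x + u)) := h x Ax.
  rewrite inE => /(_ isT)/implyP; apply; apply/eqP/setP=> z; rewrite !inE.
  apply/idP/idP=> k; last by rewrite addrAC; case: hV => _ VD; apply: VD.
  have -> : x + z = (x + u + z) + u by rewrite (addrAC x u z) addxK.
  by case: hV => _ VD; apply: VD.
have inv u : u \in V -> u \in shift_stab A.
  move=> Vu; apply/shift_stabP=> x; apply/idP/idP=> [k|]; last exact: AV.
  by rewrite -(addxK x u); apply: AV.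
by split; apply: inv.
Qed.

(** Double counting of the pairs made of a set [A] and of two distinct nonzero
    translations preserving it. *)
Lemma count_shift_stab4 (n : nat) : #|F| = (2 ^ n)%N ->
  (6 * #|[set A : {set F} | (#|A| == 12) && (#|shift_stab A| == 4)]|
    = #|F|.-1 * #|F|.-2 * 'C(#|F| %/ 4, 3))%N.
Proof.
move=> cF.
pose good (p : F * F) := [&& p.1 != 0, p.2 != 0 & p.1 != p.2].
pose inv (A : {set F}) (p : F * F) := (p.1 \in shift_stab A) && (p.2 \in shift_stab A).
transitivity (\sum_(A : {set F} | #|A| == 12) \sum_(p | good p && inv A p) 1)%N.
  rewrite -sum1dep_card big_distrr /= [RHS](bigID (fun A => #|shift_stab A| == 4)) /=.
  rewrite [X in (_ + X)%N]big1 ?addn0 => [|A /andP[/eqP cA /negPf n4]].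
    apply: eq_bigr => A /andP[/eqP cA t4]; rewrite sum1dep_card.
    have := card_shift_stab_pairs cF cA; rewrite t4 => <-.
    by apply: eq_card => p; rewrite in_set [RHS]in_set /good /inv [RHS]andbC -!andbA.
  have := card_shift_stab_pairs cF cA; rewrite n4 muln0 sum1dep_card => <-.
  by apply: eq_card => p; rewrite in_set [RHS]in_set /good /inv [LHS]andbC -!andbA.
rewrite (exchange_big_dep good) /= => [|A p _ /andP[] //].
transitivity (\sum_(p | good p) 'C(#|F| %/ 4, 3))%N.
  apply: eq_bigr => p gp; have /and3P[p1 p2 p12] := gp.
  rewrite sum1dep_card -(card_shift_invariant p1 p2 p12).
  by apply: eq_card => A; rewrite in_set [RHS]in_set /inv gp.
rewrite sum_nat_const; congr (_ * _)%N.
rewrite -cardsT -(card_distinct_pairs (in_setT 0)) -cardsE.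
by apply: eq_card => p; rewrite !inE.
Qed.

(** * Rotations of order three *)

(** Conjugating a translation by [x |-> a * x + b] multiplies its vector by [a]. *)
Lemma affine_stab_mul (A : {set F}) a b v :
  (a, b) \in affine_stab A -> v \in shift_stab A -> a * v \in shift_stab A.
Proof.
case/affine_stabP=> a0 hab /shift_stabP hv; apply/shift_stabP=> x.
have -> : x = a * ((x - b) / a) + b by field.
have -> : a * ((x - b) / a) + b + a * v = a * ((x - b) / a + v) + b by ring.
by rewrite !hab hv.
Qed.

(** Multiplication by [a] acts on the four-group of translations, without fixed
    points on its three nonzero vectors: it permutes them cyclically, and their
    sum [v + a * v + a ^+ 2 * v] vanishes. *)
Lemma affine_stab_cube_root (A : {set F}) a b :
    #|shift_stab A| = 4%N -> (a, b) \in affine_stab A -> a != 1 ->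
  a ^+ 2 + a + 1 = 0.
Proof.
move=> cT Sab a1; have [T0 TD] := shift_stab_addsub A.
have a0 : a != 0 by case/affine_stabP: Sab.
have [v Tv v0] : exists2 v, v \in shift_stab A & v != 0.
  have := cardsD1 0 (shift_stab A); rewrite T0 cT => -[cT'].
  have /card_gt0P[v /setD1P[v0 Tv]] : (0 < #|shift_stab A :\ 0%R|)%N.
    by rewrite -[#|_|]add0n -cT'.
  by exists v.
have Tav := affine_stab_mul Sab Tv; have Taav := affine_stab_mul Sab Tav.
have av0 : a * v != 0 by rewrite mulf_neq0.
have vav : v != a * v.
  by rewrite -subr_eq0 -{1}(mul1r v) -mulrBl mulf_neq0 // subr_eq0 eq_sym.
have : a * (a * v) \in [set 0; v; a * v; v + a * v].
  suff -> : [set 0; v; a * v; v + a * v] = shift_stab A by [].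
  apply/eqP; rewrite eqEcard card_klein // cT leqnn andbT.
  by rewrite !subUset !sub1set T0 Tv Tav TD.
rewrite !inE -!orbA => /or4P[] /eqP e.
- by move: (mulf_neq0 a0 av0); rewrite e eqxx.
- move: a1; rewrite -(inj_eq (mulIf v0)) mul1r.
  have : (a ^+ 2 == 1).
    by rewrite -(inj_eq (mulIf v0)) mul1r expr2 -mulrA e.
  by rewrite sqrf_eq1 oppx orbb => /eqP->; rewrite mul1r eqxx.
- by case/eqP: vav; apply: (mulfI a0).
apply: (mulIf v0); rewrite mul0r.
have -> : (a ^+ 2 + a + 1) * v = a * (a * v) + (v + a * v) by ring.
by rewrite e addxx.
Qed.

Lemma cube_root_facts (w : F) : w ^+ 2 + w + 1 = 0 ->
  [/\ w != 0, w != 1 & 1 + w = w ^+ 2].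
Proof.
move=> wr; split; last by apply/eqP; rewrite -subr_eq0 oppx addrC (addrC 1) addrA wr.
  by apply: contraTneq (oner_neq0 F) => e; rewrite -wr e expr0n /= !add0r eqxx.
by apply: contraTneq (oner_neq0 F) => e; rewrite -wr e expr1n addxx add0r eqxx.
Qed.

Section CubeRoot.
Variable w : F.
Hypothesis w_root : w ^+ 2 + w + 1 = 0.

(** The subfield with four elements and its cubic roots of unity. *)
Definition F4 : {set F} := [set x | x ^+ 4 == x].
Definition C3 : {set F} := [set x | x ^+ 3 == 1].

Let w0 : w != 0. Proof. by have [] := cube_root_facts w_root. Qed.
Let w1 : 1 != w. Proof. by have [_] := cube_root_facts w_root; rewrite eq_sym. Qed.

Lemma F4E : F4 = [set 0; 1; w; 1 + w].
Proof.
apply/setP=> x; rewrite !inE -subr_eq0.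
have -> : x ^+ 4 - x = x * (x - 1) * (x - w) * (x - (1 + w))
   + x * (x - 1) * (w ^+ 2 + w + 1) + x * (x - 1) * (x - w) * ((1 + 1) * (1 + w)) by ring.
by rewrite w_root addxx mul0r !mulr0 !addr0 !mulf_eq0 !subr_eq0.
Qed.

Lemma F4P x : x \in F4 -> [\/ x = 0, x = 1, x = w | x = 1 + w].
Proof.
rewrite F4E !inE -!orbA => /or4P[] /eqP->;
  by [constructor 1|constructor 2|constructor 3|constructor 4].
Qed.

Lemma card_F4 : #|F4| = 4%N.
Proof. by rewrite F4E card_klein ?oner_neq0. Qed.

Lemma C3E : C3 = F4 :\ 0.
Proof.
apply/setP=> x; rewrite !inE; have [->|x0] := eqVneq x 0.
  by rewrite expr0n eq_sym oner_eq0.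
have -> : (x ^+ 4 == x) = (x * x ^+ 3 == x * 1) by rewrite mulr1 -exprS.
by rewrite (inj_eq (mulfI x0)).
Qed.

Lemma card_C3 : #|C3| = 3%N.
Proof.
have := cardsD1 0 F4; rewrite C3E card_F4.
by rewrite inE expr0n eqxx add1n => -[<-].
Qed.

Let frob4D (x y : F) : (x + y) ^+ 4 = x ^+ 4 + y ^+ 4.
Proof.
have -> : (x + y) ^+ 4 = x ^+ 4 + y ^+ 4
   + (1 + 1) * (2 * x ^+ 3 * y + 3 * x ^+ 2 * y ^+ 2 + 2 * x * y ^+ 3) by ring.
by rewrite addxx mul0r addr0.
Qed.

Let F4D (x y : F) : x \in F4 -> y \in F4 -> x + y \in F4.
Proof. by rewrite !inE frob4D => /eqP-> /eqP->. Qed.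

Let F4M (x y : F) : x \in F4 -> y \in F4 -> x * y \in F4.
Proof. by rewrite !inE exprMn => /eqP-> /eqP->. Qed.

Let F4V (x : F) : x \in F4 -> x^-1 \in F4.
Proof. by rewrite !inE exprVn => /eqP->. Qed.

Let C3_F4 (a : F) : a \in C3 -> a != 0 /\ a \in F4.
Proof. by rewrite C3E => /setD1P. Qed.

Variables c v : F.
Hypothesis v0 : v != 0.

(** The coordinate taking [c] to 0 and [c + v] to 1. In this coordinate the group
    generated by the translation by [v] and the rotation [x |-> w * x + (1 + w) * c]
    is [z |-> a * z + u] with [a] in [C3] and [u] in [F4], of order 12. *)
Definition rescale (y : F) : F := (y - c) / v.

Let rescaleK y : c + v * rescale y = y.
Proof. by rewrite /rescale; field. Qed.

Let rescaleKV z : rescale (c + v * z) = z.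
Proof. by rewrite /rescale; field. Qed.

(** The complement is the orbit of [c], of size 4; the group acts regularly on
    every other orbit. *)
Definition rot_dom : {set F} := [set y | rescale y \notin F4].

(** The product of [z + u] over [u] in [F4] is [z ^+ 4 - z]; it is invariant under
    the translations by [F4] and multiplied by [a] under [z |-> a * z], so its
    cube is an invariant of the group, separating its regular orbits. *)
Definition rot_inv (y : F) : F := (rescale y ^+ 4 - rescale y) ^+ 3.

Lemma card_rot_domC : #|~: rot_dom| = 4%N.
Proof.
rewrite -card_F4 -[RHS](card_imset _ (can_inj rescaleKV)); apply: eq_card => y.
rewrite in_setC in_set negbK; apply/idP/imsetP => [h|[z + ->]].
  by exists (rescale y); rewrite ?rescaleK.
by rewrite rescaleKV.
Qed.

Lemma rot_fibre (x : F) : x \in rot_dom ->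
  [set y in rot_dom | rot_inv y == rot_inv x]
    = [set c + v * (p.1 * rescale x + p.2) | p in setX C3 F4].
Proof.
rewrite in_set => Dx; apply/setP=> y; rewrite in_set.
have Dx' : rescale x ^+ 4 - rescale x != 0 by rewrite subr_eq0; rewrite inE in Dx.
apply/andP/imsetP => [[Dy /eqP e]|[[a u] /setXP[/= Ca Fu] ->]].
  set a := (rescale y ^+ 4 - rescale y) / (rescale x ^+ 4 - rescale x).
  have Ca : a \in C3.
    by rewrite inE expr_div_n -/(rot_inv x) -/(rot_inv y) e divff // expf_neq0.
  exists (a, rescale y - a * rescale x); last by rewrite /= (addrC (a * _)) subrK rescaleK.
  rewrite inE /= Ca /=; have [_] := C3_F4 Ca; rewrite !inE oppx => /eqP a4.
  rewrite frob4D (exprMn _ a) a4 -subr_eq0.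
  have -> : rescale y ^+ 4 + a * rescale x ^+ 4 - (rescale y + a * rescale x)
    = rescale y ^+ 4 - rescale y + a * (rescale x ^+ 4 - rescale x) by ring.
  by rewrite /a divfK // addxx.
have [a0 Fa] := C3_F4 Ca; split.
  rewrite in_set rescaleKV; apply: contra Dx => h.
  have -> : rescale x = a^-1 * (a * rescale x + u + u) by rewrite addxK mulKf.
  by apply: F4M; [exact: F4V|exact: F4D].
rewrite /rot_inv rescaleKV frob4D (exprMn _ a); move: Fa Fu Ca.
rewrite !inE => /eqP-> /eqP-> /eqP a3.
have -> : a * rescale x ^+ 4 + u - (a * rescale x + u)
   = a * (rescale x ^+ 4 - rescale x) by ring.
by rewrite exprMn a3 mul1r.
Qed.

Lemma card_rot_fibre (x : F) : x \in rot_dom ->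
  #|[set y in rot_dom | rot_inv y == rot_inv x]| = 12%N.
Proof.
move=> Dx; rewrite rot_fibre // card_in_imset ?cardsX ?card_C3 ?card_F4 //.
case=> a u [a' u'] /setXP[/= Ca Fu] /setXP[/= Ca' Fu'] /= /addrI/(mulfI v0) e.
have [ea|na] := eqVneq a a'; first by move: e; rewrite -ea => /addrI->.
have h : (a + a') * rescale x = u + u'.
  apply/eqP; rewrite -subr_eq0 oppx.
  have -> : (a + a') * rescale x + (u + u')
    = a * rescale x + u + (a' * rescale x + u') by ring.
  by rewrite e addxx.
rewrite in_set in Dx; case/negP: Dx.
have -> : rescale x = (a + a')^-1 * (u + u').
  by rewrite -h mulKf // addr_eq0 oppx.
by rewrite F4M ?F4V ?F4D //; [case: (C3_F4 Ca)|case: (C3_F4 Ca')].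
Qed.

(** The orbits of size 12 partition [rot_dom], which has [#|F| - 4] points. *)
Lemma count_rot_invariant :
  (12 * #|[set A : {set F} | [&& #|A| == 12, v \in shift_stab A &
     (w, ((1 + w) * c)%R) \in affine_stab A]]| = #|F| - 4)%N.
Proof.
have cD : (#|F| - 4 = #|rot_dom|)%N by rewrite -card_rot_domC -(cardsC rot_dom) addnK.
rewrite cD (card_fibres card_rot_fibre) mulnC; congr (_ * _)%N.
rewrite -[RHS]bin1 -(card_saturated 1 (isT : 0 < 12)%N card_rot_fibre).
apply: eq_card => A; rewrite [LHS]in_set [RHS]in_set.
have wC : w \in C3 by rewrite C3E F4E !inE w0 eqxx !orbT.
have F41 : 1 \in F4 by rewrite inE expr1n.
have F40 : 0 \in F4 by rewrite inE expr0n.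
have C31 : 1 \in C3 by rewrite inE expr1n.
have [cA|] := eqVneq #|A| 12%N; rewrite ?andbF //=.
apply/andP/andP=> [[hv hw]|[sA /forall_inP satA]].
  have Tu u : u \in F4 -> v * u \in shift_stab A.
    have [T0 TD] := shift_stab_addsub A; have Twv := affine_stab_mul hw hv.
    case/F4P=> ->; rewrite ?mulr0 ?mulr1 //.
      by rewrite mulrC.
    by rewrite mulrDr mulr1 TD // mulrC.
  have hw1 y : y \in A -> c + v * (w * rescale y) \in A.
    case/affine_stabP: hw => _ h; rewrite -(h y); congr (_ \in A).
    have -> : w * y + (1 + w) * c = c + v * (w * rescale y) + (1 + 1) * w * c.
      by rewrite /rescale; field.
    by rewrite addxx !mul0r addr0.
  have hC y a : a \in C3 -> y \in A -> c + v * (a * rescale y) \in A.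
    rewrite C3E => /setD1P[a0 /F4P[]] ea; first (by rewrite ea eqxx in a0); rewrite ea.
    - by rewrite mul1r rescaleK.
    - exact: hw1.
    have [_ _ w2] := cube_root_facts w_root.
    by move=> /hw1/hw1; rewrite rescaleKV (mulrA w w) w2.
  have hCF y a u : a \in C3 -> u \in F4 -> y \in A ->
      c + v * (a * rescale y + u) \in A.
    move=> Ca Fu Ay; rewrite mulrDr addrA.
    by have /shift_stabP-> := Tu u Fu; apply: hC.
  have satA y : y \in A -> y \in rot_dom ->
      [set z in rot_dom | rot_inv z == rot_inv y] \subset A.
    move=> Ay Dy; rewrite rot_fibre //.
    by apply/subsetP=> _ /imsetP[[a u] /setXP[Ca Fu] ->]; apply: hCF.
  have AD : (12 %| #|A :&: rot_dom|)%N.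
    rewrite (@card_fibres _ _ rot_inv _ 12) ?dvdn_mull // => x /setIP[Ax Dx].
    rewrite -(card_rot_fibre Dx); apply: eq_card => z.
    rewrite [LHS]in_set in_setI -andbA [RHS]in_set; apply/andb_idl=> /andP[Dz e].
    by apply: (subsetP (satA x Ax Dx)); rewrite in_set Dz.
  (* [A] has 8 to 12 points in [rot_dom], and their number is divisible by 12. *)
  have sA : A \subset rot_dom.
    have := cardsID rot_dom A; rewrite cA.
    have : (#|A :\: rot_dom| <= 4)%N.
      by rewrite -card_rot_domC subset_leq_card // setDE subsetIr.
    have [k ->] := dvdnP AD => l4 e.
    have k1 : k = 1%N by lia.
    by rewrite -setD_eq0 -cards_eq0; apply/eqP; lia.
  split=> //; apply/forall_inP=> x Ax; apply/forall_inP=> y Dy.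
  apply/implyP=> e; apply: (subsetP (satA x Ax (subsetP sA x Ax))).
  by rewrite in_set Dy.
have hCF y a u : a \in C3 -> u \in F4 -> y \in A ->
    c + v * (a * rescale y + u) \in A.
  move=> Ca Fu Ay; have Dy := subsetP sA y Ay.
  have : c + v * (a * rescale y + u) \in [set z in rot_dom | rot_inv z == rot_inv y].
    by rewrite rot_fibre //; apply/imsetP; exists (a, u); rewrite // inE /= Ca Fu.
  rewrite in_set => /andP[Dz e].
  by have /forall_inP/(_ _ Dz)/implyP := satA y Ay; apply.
have hv y : y \in A -> y + v \in A.
  move=> Ay; have := hCF y 1 1 C31 F41 Ay.
  by rewrite mul1r mulrDr addrA rescaleK mulr1.
split.
  apply/shift_stabP=> x; apply/idP/idP=> [/hv|]; last exact: hv.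
  by rewrite addxK.
have wE a x : c + v * (a * rescale x + 0) = a * x + (1 + a) * c.
  have -> : c + v * (a * rescale x + 0) = a * x + (1 - a) * c.
    by rewrite /rescale; field.
  by rewrite oppx.
apply/affine_stabP; split=> // x; rewrite -wE; apply/idP/idP=> [h|]; last exact: hCF.
have Cw : w^-1 \in C3.
  by rewrite inE exprVn; move: wC; rewrite inE => /eqP->; rewrite invr1.
have := hCF _ _ 0 Cw F40 h; rewrite rescaleKV !addr0 mulKf //.
by rewrite rescaleK.
Qed.

End CubeRoot.

Definition has_rotation (A : {set F}) := [exists ab in affine_stab A, ab.1 != 1].

Lemma affine_stab_comp (A : {set F}) a b a' b' :
  (a, b) \in affine_stab A -> (a', b') \in affine_stab A ->
  (a' * a, a' * b + b') \in affine_stab A.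
Proof.
move=> /affine_stabP[a0 h] /affine_stabP[a0' h']; apply/affine_stabP.
split=> [|x]; first exact: mulf_neq0.
by rewrite -(h x) -(h' (a * x + b)); congr (_ \in A); ring.
Qed.

(** The second component [v] ranges over the 3 nonzero translations. The first one
    ranges over the centres of rotations with multiplier [w]; once one exists, they
    form a coset of the group of translations, whence 4 of them. A rotation with
    multiplier [w ^+ 2] gives one with multiplier [w] by squaring. Conversely, a
    rotation and a nonzero translation [v] provide the translation [w * v], hence
    four translations. *)
Lemma card_rot_centres (w : F) (n : nat) (A : {set F}) :
    w ^+ 2 + w + 1 = 0 -> #|F| = (2 ^ n)%N -> #|A| = 12%N ->
  #|[set p : F * F | [&& p.2 != 0, p.2 \in shift_stab A &
     (w, ((1 + w) * p.1)%R) \in affine_stab A]]|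
    = (12 * ((#|shift_stab A| == 4) && has_rotation A))%N.
Proof.
move=> wr cF cA; have [T0 TD] := shift_stab_addsub A.
have [w0 w1 w2] := cube_root_facts wr.
have [/andP[/eqP t4 rotA]|notT] := boolP (_ && _).
  have [c0 Sc0] : exists c0, (w, (1 + w) * c0) \in affine_stab A.
    have [b Sb] : exists b, (w, b) \in affine_stab A.
      case/existsP: rotA => -[a b] /andP[Sab /= a1].
      have ar := affine_stab_cube_root t4 Sab a1.
      have : (a - w) * (a + (1 + w)) == 0.
        have -> : (a - w) * (a + (1 + w)) = a ^+ 2 + a + 1 - (w ^+ 2 + w + 1) by ring.
        by rewrite ar wr subr0.
      rewrite mulf_eq0 subr_eq0 addr_eq0 oppx w2 => /orP[] /eqP ea.
        by exists b; rewrite -ea.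
      exists (a * b + b); have := affine_stab_comp Sab Sab.
      suff -> : a * a = w by [].
      apply/eqP; rewrite -subr_eq0 oppx.
      have -> : a * a + w = a ^+ 2 + a + 1 - (a + (1 + w)) + (w + w) by ring.
      by rewrite ar ea w2 !addxx subr0 addr0.
    by exists (b / w ^+ 2); rewrite w2 mulrC divfK // expf_neq0.
  transitivity #|setX [set c | c + c0 \in shift_stab A] (shift_stab A :\ 0)|.
    apply: eq_card => -[c v]; rewrite in_set in_setX in_setD1 /=.
    rewrite andbA [RHS]andbC; congr (_ && _).
    (* [wT] holds as [w] has order 3; the rotations about [c] and [c0] differ by
       the translation by [(1 + w) * (c + c0)], that is [w ^+ 2 * (c + c0)]. *)
    have wT u : (w * u \in shift_stab A) = (u \in shift_stab A).
      apply/idP/idP => [|]; last exact: (affine_stab_mul Sc0).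
      move/(affine_stab_mul Sc0)/(affine_stab_mul Sc0).
      suff -> : w * (w * (w * u)) = u by [].
      have -> : w * (w * (w * u)) = (w ^+ 2 + w + 1) * (w - 1) * u + u by ring.
      by rewrite wr !mul0r add0r.
    rewrite [RHS]in_set -(wT (c + c0)) -(wT (w * _)) mulrA -expr2 -w2.
    case/affine_stabP: (Sc0) => _ h0.
    apply/affine_stabP/shift_stabP => [[_ h] x|h].
      have -> : x = w * (w^-1 * (x + (1 + w) * c0)) + (1 + w) * c0.
        by rewrite mulVKf // addxK.
      rewrite h0 -(h (w^-1 * (x + (1 + w) * c0))) mulVKf // addxK.
      by congr (_ \in A); ring.
    split=> // x; rewrite -(h0 x) -(h (w * x + (1 + w) * c0)).
    have -> : w * x + (1 + w) * c0 + (1 + w) * (c + c0)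
      = w * x + (1 + w) * c + ((1 + w) * c0 + (1 + w) * c0) by ring.
    by rewrite addxx addr0.
  rewrite cardsX muln1 -[RHS]/(4 * 3)%N; congr (_ * _)%N.
    rewrite -[RHS]t4 -[RHS](card_imset _ (addIr c0)); apply: eq_card => c.
    rewrite in_set; apply/idP/imsetP => [h|[u Tu ->]]; last by rewrite addxK.
    by exists (c + c0); rewrite ?addxK.
  by have := cardsD1 0 (shift_stab A); rewrite T0 t4 add1n => -[].
rewrite muln0; apply/eqP; rewrite cards_eq0 -subset0; apply/subsetP=> -[c v].
rewrite in_set => /and3P[/= v0 Tv Sw]; case/negP: notT; apply/andP; split.
  have Twv := affine_stab_mul Sw Tv.
  have s3 : [set 0; v; w * v] \subset shift_stab A.
    by rewrite !subUset !sub1set T0 Tv Twv.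
  have c3 : #|[set 0; v; w * v]| = 3%N.
    rewrite -setUA !cardsU1 cards1 !inE !negb_or !(eq_sym 0) v0 mulf_neq0 //=.
    by rewrite -[v in v == _]mul1r (inj_eq (mulIf v0)) eq_sym w1.
  have := subset_leq_card s3; rewrite c3.
  by have := card_shift_stab cF cA; rewrite !inE => /or3P[] /eqP->.
by rewrite /has_rotation; apply/exists_inP; exists (w, (1 + w) * c).
Qed.

(** Double counting of the triples [(A, c, v)] with [A] invariant under the rotation
    about [c] and the translation by [v]: there are 12 pairs [(c, v)] for each [A],
    and [(#|F| - 4) / 12] sets [A] for each pair. *)
Lemma count_rotation (w : F) (n : nat) :
    w ^+ 2 + w + 1 = 0 -> #|F| = (2 ^ n)%N ->
  (144 * #|[set A : {set F} | [&& #|A| == 12, #|shift_stab A| == 4 & has_rotation A]]|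
    = #|F| * #|F|.-1 * (#|F| - 4))%N.
Proof.
move=> wr cF.
pose good (p : F * F) := p.2 != 0.
pose inv (A : {set F}) (p : F * F) :=
  (p.2 \in shift_stab A) && ((w, (1 + w) * p.1) \in affine_stab A).
have e : (12 * #|[set A : {set F} | [&& #|A| == 12, #|shift_stab A| == 4 & has_rotation A]]|
   = \sum_(A : {set F} | #|A| == 12) \sum_(p | good p && inv A p) 1)%N.
  rewrite -sum1dep_card big_distrr /=.
  rewrite [RHS](bigID (fun A => (#|shift_stab A| == 4) && has_rotation A)) /=.
  rewrite [X in (_ + X)%N]big1 ?addn0 => [|A /andP[/eqP cA /negPf nA]].
    apply: eq_bigr => A /andP[/eqP cA tA]; rewrite sum1dep_card.
    have := card_rot_centres wr cF cA; rewrite tA => <-.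
    by apply: eq_card => p; rewrite in_set.
  have := card_rot_centres wr cF cA; rewrite nA muln0 sum1dep_card => <-.
  by apply: eq_card => p; rewrite in_set.
rewrite -[144%N]/(12 * 12)%N -mulnA e (exchange_big_dep good) /= => [|A p _ /andP[] //].
rewrite big_distrr /= (eq_bigr (fun=> #|F| - 4)%N) => [|p gp].
  rewrite sum_nat_const; congr (_ * _)%N.
  transitivity #|setX [set: F] ([set: F] :\ 0)|.
    by apply: eq_card => -[c v]; rewrite !inE /good /= andbT.
  rewrite cardsX cardsT; congr (_ * _)%N.
  by rewrite -cardsT [in RHS](cardsD1 0) in_setT.
rewrite sum1dep_card -(count_rot_invariant wr p.1 gp); congr (_ * _)%N.
by apply: eq_card => A; rewrite in_set [RHS]in_set /inv gp.
Qed.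

Lemma card_affine_stab_norot (A : {set F}) :
  ~~ has_rotation A -> #|affine_stab A| = #|shift_stab A|.
Proof.
rewrite /has_rotation negb_exists_in => /forall_inP h.
have inj1 : injective (pair (1 : F) : F -> F * F) by move=> x y [].
rewrite -[RHS](card_imset _ inj1); apply: eq_card => -[a b].
apply/idP/imsetP => [Sab|[u Tu [-> ->]]]; last by rewrite affine_stab1.
have /negPn/eqP /= a1 := h _ Sab; rewrite a1 in Sab *.
by exists b; rewrite // -affine_stab1.
Qed.

(** For [n] even, 3 divides the order [2 ^ n - 1] of the multiplicative group. *)
Lemma cube_root_exists (n : nat) : #|F| = (2 ^ n)%N -> ~~ odd n -> (0 < n)%N ->
  exists w : F, w ^+ 2 + w + 1 = 0.
Proof.
move=> cF ev n0.
have d3 : (3 %| #|[set: {unit F}]|)%N.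
  rewrite card_finField_unit cF -subn1 -[n]odd_double_half (negPf ev) add0n.
  rewrite -mul2n expnM -eqn_mod_dvd ?expn_gt0 // -modnXm.
  by rewrite exp1n.
have [u _ ou] := Cauchy (isT : prime 3) d3.
exists (val u).
have u1 : val u - 1 != 0.
  rewrite subr_eq0; apply/eqP=> e; have : u = 1%g by exact: val_inj.
  by move=> e1; move: ou; rewrite e1 order1.
apply: (mulfI u1); rewrite mulr0.
have -> : (val u - 1) * (val u ^+ 2 + val u + 1) = val u ^+ 3 - 1 by ring.
have -> : val u ^+ 3 = val (u ^+ 3)%g.
  by rewrite !expgS expg0 /= mulr1 !exprS expr0 mulr1.
by rewrite -ou expg_order subrr.
Qed.

(** Here [#|F|] is 2 modulo 3, so [a ^+ 3 = 1] and [a ^+ #|F| = a] force [a = 1]. *)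
Lemma odd_no_rotation (n : nat) (A : {set F}) : #|F| = (2 ^ n)%N -> odd n ->
  #|shift_stab A| = 4%N -> ~~ has_rotation A.
Proof.
move=> cF on cT; rewrite /has_rotation negb_exists_in; apply/forall_inP=> -[a b] Sab /=.
apply/negP=> a1.
have ar : a ^+ 2 + a + 1 = 0 := affine_stab_cube_root cT Sab a1.
have a3 : a ^+ 3 = 1.
  apply/eqP; rewrite -subr_eq0.
  have -> : a ^+ 3 - 1 = (a - 1) * (a ^+ 2 + a + 1) by ring.
  by rewrite ar mulr0.
have a0 : a != 0 by case/affine_stabP: Sab.
have : a ^+ #|F| = a by exact: expf_card.
have -> : #|F| = (3 * (#|F| %/ 3) + 2)%N.
  rewrite {1}(divn_eq #|F| 3) mulnC; congr (_ + _)%N.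
  rewrite cF -[n]odd_double_half on add1n expnS -mul2n expnM -modnMmr -modnXm.
  by rewrite exp1n.
rewrite exprD exprM a3 expr1n mul1r expr2 => /eqP.
by rewrite -[a in _ == a]mulr1 (inj_eq (mulfI a0)) (negPf a1).
Qed.

End Translations.

(** * The sharply 3-transitive action on the projective line *)

Section ProjectiveLine.
Variable F : finFieldType.
Local Notation G := (PSL2_group F).
Local Notation X := (option F).

Lemma PSL2_affine (a b : F) : a != 0 ->
  exists g, [/\ g \in G, g None = None & forall z, g (Some z) = Some (a * z + b)].
Proof.
move=> a0; have D : a * 1 - b * 0 != 0 by rewrite mulr1 mulr0 subr0.
exists (perm (mobius_inj D)); split=> [||z]; first exact: mobius_in_PSL2.
  by rewrite permE /= eqxx.
by rewrite permE /= mul0r add0r oner_eq0 divr1.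
Qed.

Lemma PSL2_fix_inf g : g \in G -> g None = None ->
  exists a b : F, a != 0 /\ forall z, g (Some z) = Some (a * z + b).
Proof.
case/PSL2P=> a [b [c [d [D E]]]]; rewrite E /=; case: eqP => // c0 _.
have [a0 d0] : a != 0 /\ d != 0.
  by apply/andP; rewrite -negb_or -mulf_eq0; move: D; rewrite c0 mulr0 subr0.
exists (a / d), (b / d); split=> [|z]; first by rewrite mulf_neq0 ?invr_eq0.
by rewrite E /= c0 mul0r add0r (negPf d0); congr Some; field.
Qed.

Lemma PSL2_to_inf (p : X) : exists2 g, g \in G & g p = None.
Proof.
case: p => [z|]; last by exists 1%g; rewrite ?group1 // perm1.
have D : 0 * (- z) - 1 * 1 != 0 :> F by rewrite mul0r sub0r mulr1 oppr_eq0 oner_eq0.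
exists (perm (mobius_inj D)); first exact: mobius_in_PSL2.
by rewrite permE /= mul1r subrr eqxx.
Qed.

Lemma set_stabP (B : {set X}) (g : {perm X}) :
  reflect (forall x, (g x \in B) = (x \in B)) (g \in 'C[B | 'P^*])%g.
Proof. by rewrite astab1_set; apply: (iffP astabsP) => h x; have := h x. Qed.

Lemma fix_infP (g : {perm X}) : reflect (g None = None) (g \in 'C[None | 'P])%g.
Proof. by apply: (iffP astab1P); rewrite /= apermE. Qed.

(** An affine map is determined by its values at 0 and 1. *)
Lemma card_inf_stab (B : {set X}) :
  #|'C_('C_G[B | 'P^*])[None | 'P]%g| = #|affine_stab (Some @^-1: B)|.
Proof.
pose phi (g : {perm X}) : F * F :=
  let b := odflt 0 (g (Some 0)) in (odflt 0 (g (Some 1)) - b, b).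
have phiE (g : {perm X}) a b : (forall z, g (Some z) = Some (a * z + b)) ->
    phi g = (a, b).
  by move=> E; rewrite /phi !E /= mulr0 add0r mulr1 addrK.
rewrite -(card_in_imset (f := phi)) => [|g h].
  apply: eq_card => -[a b]; apply/imsetP/affine_stabP => [[g]|[a0 hab]].
    case/setIP=> /setIP[Gg /set_stabP Bg] /fix_infP gN.
    have [a' [b' [a'0 E]]] := PSL2_fix_inf Gg gN; rewrite (phiE _ _ _ E).
    by case=> -> ->; split=> // x; have := Bg (Some x); rewrite E !inE.
  have [g [Gg gN E]] := PSL2_affine b a0; exists g; last by rewrite (phiE _ _ _ E).
  apply/setIP; split; last exact/fix_infP.
  apply/setIP; split=> //; apply/set_stabP=> -[z|]; last by rewrite gN.
  by have := hab z; rewrite E !inE.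
move=> /setIP[/setIP[Gg _] /fix_infP gN] /setIP[/setIP[Gh _] /fix_infP hN].
have [a [b [_ E]]] := PSL2_fix_inf Gg gN; have [a' [b' [_ E']]] := PSL2_fix_inf Gh hN.
rewrite (phiE _ _ _ E) (phiE _ _ _ E') => -[ea eb].
by apply/permP=> -[z|]; rewrite ?gN ?hN // E E' ea eb.
Qed.

Lemma card_PSL2 : #|G| = (#|F|.+1 * (#|F|.-1 * #|F|))%N.
Proof.
rewrite -(card_orbit_stab 'P G None); congr (_ * _)%N.
  rewrite -card_option -cardsT; congr #|pred_of_set _|; apply/setP=> p; rewrite inE.
  have [g Gg gp] := PSL2_to_inf p; apply/orbitP; exists (g^-1)%g.
    by rewrite groupV.
  by rewrite -gp; apply: permK.
have <- : 'C_('C_G[[set: X] | 'P^*])[None | 'P]%g = 'C_G[None | 'P]%g.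
  congr (_ :&: _); apply/setIidPl/subsetP=> g _.
  by apply/set_stabP=> x; rewrite !inE.
rewrite card_inf_stab -(cardsT F) -[_.-1]/(#|[set: F]|.-1).
transitivity #|setX ([set: F] :\ 0) [set: F]|.
  apply: eq_card => -[a b]; rewrite !inE /= !andbT; apply: andb_idr => _.
  by apply/forallP=> x; rewrite !inE.
rewrite cardsX; congr (_ * _)%N.
by rewrite [in RHS](cardsD1 0) in_setT.
Qed.

(** Conjugation moves [x] to infinity, and an affine map with two fixed points is
    the identity. *)
Lemma PSL2_fix3 g (x y z : X) : g \in G -> x != y -> x != z -> y != z ->
  g x = x -> g y = y -> g z = z -> g = 1%g.
Proof.
move=> Gg xy xz yz gx gy gz; have [h Gh hx] := PSL2_to_inf x.
suff : (g ^ h = 1)%g by move/eqP; rewrite conjg_eq1 => /eqP.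
have Gk : (g ^ h)%g \in G by rewrite groupJ.
have kN : (g ^ h)%g None = None by rewrite -hx permJ gx.
have [a [b [a0 E]]] := PSL2_fix_inf Gk kN.
have [u hy] : exists u, h y = Some u.
  case e: (h y) => [u|]; first by exists u.
  by case/eqP: xy; apply: (@perm_inj _ h); rewrite hx e.
have [v hz] : exists v, h z = Some v.
  case e: (h z) => [v|]; first by exists v.
  by case/eqP: xz; apply: (@perm_inj _ h); rewrite hx e.
have uv : u != v by apply: contra yz => /eqP e; rewrite -(inj_eq (@perm_inj _ h)) hy hz e.
have : (g ^ h)%g (Some u) = Some u by rewrite -hy permJ gy.
have : (g ^ h)%g (Some v) = Some v by rewrite -hz permJ gz.
rewrite !E => -[ev] [eu].
have a1 : a = 1.
  apply: (mulIf (_ : u - v != 0)); first by rewrite subr_eq0.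
  by rewrite mul1r -[in RHS]eu -[in RHS]ev; ring.
have b0 : b = 0 by apply: (addrI u); rewrite addr0 -[in RHS]eu a1 mul1r.
apply/permP=> -[t|]; rewrite perm1 ?kN // E a1 b0 mul1r addr0 //.
Qed.

Lemma card_fix_PSL2 (g : {perm X}) (S : {set X}) : g \in G -> (g != 1)%g ->
  (#|'Fix_(S | 'P)(<[g]>)%g| <= 2)%N.
Proof.
move=> Gg; apply: contraNT; rewrite -ltnNge => /card_gt2P[x [y [z [[]]]]].
have fix_g t : t \in 'Fix_(S | 'P)(<[g]>)%g -> g t = t.
  by case/setIP=> _ /afixP/(_ g (cycle_id g)).
move=> /fix_g gx /fix_g gy /fix_g gz [xy yz zx].
by apply/eqP/(PSL2_fix3 Gg xy _ yz) => //; rewrite eq_sym.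
Qed.

Lemma acts_cycle (g : {perm X}) (S : {set X}) :
  (forall x, (g x \in S) = (x \in S)) -> [acts <[g]>, on S | 'P]%g.
Proof. by move=> gS; rewrite cycle_subG; apply/astabsP=> x; exact: gS. Qed.

Lemma PSL2_3homogeneous (T : {set X}) : #|T| = 3%N ->
  exists2 h, h \in G & ('P^*)%act T h = [set None; Some 0; Some 1].
Proof.
move=> cT; have [x Tx] : exists x, x \in T by apply/card_gt0P; rewrite cT.
have cTx : #|T :\ x| = 2%N by move: cT; rewrite (cardsD1 x) Tx add1n => -[].
have /eqP/cards2P[y [z [yz eT]]] := cTx.
have /setD1P[yx Ty] : y \in T :\ x by rewrite eT !inE eqxx.
have /setD1P[zx Tz] : z \in T :\ x by rewrite eT !inE eqxx orbT.
have [h Gh hx] := PSL2_to_inf x.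
have [u hy] : exists u, h y = Some u.
  case e: (h y) => [u|]; first by exists u.
  by case/eqP: yx; apply: (@perm_inj _ h); rewrite hx e.
have [v hz] : exists v, h z = Some v.
  case e: (h z) => [v|]; first by exists v.
  by case/eqP: zx; apply: (@perm_inj _ h); rewrite hx e.
have uv : v - u != 0.
  by rewrite subr_eq0; apply: contra yz => /eqP e; rewrite -(inj_eq (@perm_inj _ h)) hy hz e.
have iuv : (v - u)^-1 != 0 by rewrite invr_eq0.
have [g [Gg gN E]] := PSL2_affine (- u / (v - u)) iuv.
exists (h * g)%g; first by rewrite groupM.
have -> : T = [set x; y; z] by rewrite -setUA -eT setD1K.
rewrite /= /setact !imsetU !imset_set1 /= /aperm !permM hx hy hz gN !E.
have -> : (v - u)^-1 * u + - u / (v - u) = 0 by field.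
by have -> : (v - u)^-1 * v + - u / (v - u) = 1 by field.
Qed.

(** * Orbits as 3-designs *)

Lemma set_stab_act (B : {set X}) (h : {perm X}) : h \in G ->
  'C_G[('P^*)%act B h | 'P^*]%g = ('C_G[B | 'P^*] :^ h)%g.
Proof. by move=> Gh; rewrite astab1_act [RHS]conjIg conjGid. Qed.

Definition stab4_sets : {set {set X}} :=
  [set B : {set X} | (#|B| == 13) && (#|'C_G[B | 'P^*]%g| == 4)].

Lemma stab4_sets_act (B : {set X}) (h : {perm X}) : h \in G ->
  (('P^*)%act B h \in stab4_sets) = (B \in stab4_sets).
Proof. by move=> Gh; rewrite [LHS]in_set [RHS]in_set set_stab_act // cardJg card_setact. Qed.

Definition blocks_through (B T : {set X}) :=
  [set C in orbit 'P^* G B | T \subset C].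

Lemma card_blocks_through (B T T' : {set X}) : #|T| = 3%N -> #|T'| = 3%N ->
  #|blocks_through B T| = #|blocks_through B T'|.
Proof.
have sub h (T1 T2 : {set X}) : h \in G -> ('P^*)%act T1 h = T2 ->
    #|blocks_through B T1| = #|blocks_through B T2|.
  move=> Gh <-; rewrite -(card_imset _ (act_inj 'P^* h)); apply: eq_card => C.
  have sE (C1 C2 : {set X}) k : (('P^*)%act C1 k \subset ('P^*)%act C2 k) = (C1 \subset C2).
    rewrite /= /setact; apply/idP/idP; last exact: imsetS.
    move/subsetP=> s; apply/subsetP=> x Cx.
    by have /imsetP[y Cy /perm_inj ->] := s _ (imset_f _ Cx).
  rewrite [RHS]in_set; apply/imsetP/andP => [[C' + ->]|[BC TC]].
    by rewrite in_set sE orbit_actr // => /andP[].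
  exists (('P^*)%act C (h^-1)%g); last by rewrite actKV.
  by rewrite in_set orbit_actr ?groupV // BC -(sE _ _ h) actKV.
move=> /PSL2_3homogeneous[h Gh eh] /PSL2_3homogeneous[h' Gh' eh'].
by rewrite (sub h _ _ Gh eh) (sub h' _ _ Gh' eh').
Qed.

(** Counting the pairs (triple, block containing it) in two ways determines the
    number of blocks through a triple: times the order of the stabiliser of [B] it
    is [6 * 'C(13, 3) = 1716]. *)
Lemma is_design_orbit (B : {set X}) : #|B| = 13%N ->
  is_design 3 #|F|.+1 13 429 (orbit 'P^* G B) = (#|'C_G[B | 'P^*]%g| == 4%N).
Proof.
move=> cB.
have cD C : C \in orbit 'P^* G B -> #|C| = 13%N.
  by case/orbitP=> g _ <-; rewrite card_setact.
have [T0 sT0 cT0] : exists2 T0 : {set X}, T0 \subset B & #|T0| = 3%N.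
  have : (0 < #|[set T : {set X} | T \subset B & #|T| == 3]|)%N by rewrite cards_draws cB.
  by case/card_gt0P=> T0; rewrite inE => /andP[s /eqP]; exists T0.
have dbl : ('C(#|F|.+1, 3) * #|blocks_through B T0| = #|orbit 'P^* G B| * 286)%N.
  transitivity (\sum_(T : {set X} | #|T| == 3) \sum_(C in orbit 'P^* G B | T \subset C) 1)%N.
    rewrite -[#|F|.+1]card_option -card_draws -sum1dep_card big_distrl /=.
    apply: eq_bigr => T /eqP cT; rewrite mul1n (card_blocks_through B cT0 cT).
    by rewrite sum1dep_card.
  rewrite (exchange_big_dep (mem (orbit 'P^* G B))) /= => [|? ? _ /andP[] //].
  rewrite -sum_nat_const; apply: eq_bigr => C DC.
  rewrite sum1dep_card -[286%N]/'C(13, 3) -(cD C DC) -cards_draws.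
  by apply: eq_card => T; rewrite !in_set DC andbC.
have osE : (#|orbit 'P^* G B| * #|'C_G[B | 'P^*]%g| = 'C(#|F|.+1, 3) * 6)%N.
  by rewrite card_orbit_stab card_PSL2 bin3.
have C0 : (0 < 'C(#|F|.+1, 3))%N.
  rewrite bin_gt0 -card_option -cardsT; apply: leq_trans (subset_leq_card (subsetT B)).
  by rewrite cB.
have lamE : (#|blocks_through B T0| * #|'C_G[B | 'P^*]%g| = 1716)%N.
  apply/eqP; rewrite -(eqn_pmul2l C0) mulnA dbl mulnAC osE -mulnA.
  by [].
have -> : is_design 3 #|F|.+1 13 429 (orbit 'P^* G B) = (#|blocks_through B T0| == 429%N).
  rewrite /is_design card_option eqxx /=; apply/andP/idP => [[_ /forallP/(_ T0)]|l].
    by rewrite cT0.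
  split; first by apply/forall_inP=> C /cD ->.
  by apply/forallP=> T; apply/implyP=> /eqP cT; rewrite (card_blocks_through B cT cT0).
apply/eqP/eqP => e; move: lamE; rewrite e => e'.
  by apply/eqP; rewrite -(eqn_pmul2l (isT : 0 < 429)%N) e'.
by apply/eqP; rewrite -(eqn_pmul2r (isT : 0 < 4)%N) e'.
Qed.

Lemma m429E : (m F 429 * #|G| = 4 * #|stab4_sets|)%N.
Proof.
have actS : [acts G, on stab4_sets | 'P^*]%g.
  by apply/subsetP=> h Gh; apply/astabsP=> B; rewrite stab4_sets_act.
rewrite -(acts_sum_card_orbit actS) big_distrr /= /m -sum_nat_const.
rewrite (eq_bigl (fun D => D \in [set orbit 'P^* G B | B in stab4_sets])).
  apply: eq_bigr => _ /imsetP[B + ->]; rewrite in_set => /andP[_ /eqP cK].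
  by rewrite -(card_orbit_stab 'P^* G B) cK mulnC.
move=> D; rewrite in_set; apply/andP/imsetP => [[/imsetP[B cB ->]]|[B + ->]].
  rewrite inE in cB; rewrite is_design_orbit; last exact/eqP.
  by move=> cK; exists B; rewrite // in_set cB cK.
rewrite in_set => /andP[cB cK]; rewrite is_design_orbit; last exact/eqP.
by split=> //; apply/imsetP; exists B; rewrite ?inE.
Qed.

(** * Fixed points of 2-subgroups in characteristic 2 *)

Hypothesis even_q : ~~ odd #|F|.

(** The number of fixed points in [S] has the parity of [#|S|], and it is at most
    two by sharp 3-transitivity. *)
Lemma two_group_fix1 (H : {group {perm X}}) (S : {set X}) :
    H \subset G -> H :!=: 1%g -> (2.-group H)%g -> odd #|S| ->
    [acts H, on S | 'P]%g ->
  #|'Fix_(S | 'P)(H)%g| = 1%N.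
Proof.
move=> sHG /trivgPn[g Hg g1] H2 oS actS; have := pgroup_fix_mod H2 actS.
have : (#|'Fix_(S | 'P)(H)%g| <= 2)%N.
  apply: leq_trans (card_fix_PSL2 S (subsetP sHG g Hg) g1).
  by rewrite subset_leq_card // setIS // afixS // cycle_subG.
by rewrite !modn2 oS; case: #|_| => [|[|[|]]].
Qed.

Lemma two_group_fix_uniq (H : {group {perm X}}) (x y : X) :
    H \subset G -> H :!=: 1%g -> (2.-group H)%g ->
    {in H, forall g : {perm X}, g x = x} -> {in H, forall g : {perm X}, g y = y} -> x = y.
Proof.
move=> sHG H1 H2 Hx Hy.
have oX : odd #|[set: X]| by rewrite cardsT card_option.
have actX : [acts H, on [set: X] | 'P]%g.
  by apply/subsetP=> g _; apply/astabsP=> t; rewrite !inE.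
have /eqP/cards1P[z fz] := two_group_fix1 sHG H1 H2 oX actX.
have fix_z t : {in H, forall g : {perm X}, g t = t} -> t = z.
  by move=> Ht; apply/set1P; rewrite -fz inE in_setT; apply/afixP=> g /Ht.
by rewrite (fix_z x Hx) (fix_z y Hy).
Qed.

Lemma two_elt_fix_uniq (g : {perm X}) (x y : X) : g \in G -> (g != 1)%g ->
  (2.-elt g)%g -> g x = x -> g y = y -> x = y.
Proof.
move=> Gg g1 g2 gx gy.
have fixX t : g t = t -> {in <[g]>%g, forall h : {perm X}, h t = t}.
  by move=> gt h /cycleP[i ->]; rewrite permX; elim: i => //= i ->.
apply: (@two_group_fix_uniq <[g]>%G); rewrite ?cycle_subG ?cycle_eq1 //; exact: fixX.
Qed.

Hypothesis char2 : 2%N \in [pchar F].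

(** An affine map with multiplier [a != 1] has a fixed point besides infinity. *)
Lemma two_elt_translation (g : {perm X}) a b : g \in G -> g None = None ->
  (2.-elt g)%g -> (forall z, g (Some z) = Some (a * z + b)) -> a = 1.
Proof.
move=> Gg gN g2 E; apply/eqP; rewrite -subr_eq0 oppr_pchar2 //; apply/negPn/negP=> a1.
have gfix : g (Some (b / (a + 1))) = Some (b / (a + 1)).
  rewrite E; congr Some; apply/eqP; rewrite -subr_eq0 oppr_pchar2 //.
  have -> : a * (b / (a + 1)) + b + b / (a + 1) = b + b by field.
  by rewrite addrr_pchar2.
have [g1|g1] := eqVneq g 1%g; last by have := two_elt_fix_uniq Gg g1 g2 gN gfix.
case/negP: a1; have := E 1; have := E 0; rewrite g1 !perm1 mulr0 add0r => -[<-] [].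
by rewrite mulr1 addr0 => <-; rewrite addrr_pchar2.
Qed.

Lemma two_elt_inf_inv (g : {perm X}) : g \in G -> g None = None -> (2.-elt g)%g ->
  (g * g = 1)%g.
Proof.
move=> Gg gN g2; have [a [b [_ E]]] := PSL2_fix_inf Gg gN.
have a1 := two_elt_translation Gg gN g2 E.
apply/permP=> -[z|]; rewrite permM perm1; last by rewrite !gN.
by rewrite !E a1 !mul1r -addrA addrr_pchar2 // addr0.
Qed.

(** * The stabiliser of a 13-set with four affine symmetries *)

Section Stabiliser.
Variable B : {set X}.
Local Notation K := 'C_G[B | 'P^*]%g.
Local Notation K0 := 'C_K[None | 'P]%g.
Hypothesis cB : #|B| = 13%N.
Hypothesis BN : None \in B.
Hypothesis cK0 : #|K0| = 4%N.

Let K0P t : t \in K0 -> [/\ t \in K, t \in G, t None = None & (2.-elt t)%g].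
Proof.
move=> K0t; case/setIP: (K0t) => Kt /fix_infP tN; split=> //.
  by case/setIP: Kt.
by apply: (mem_p_elt (G := K0)); rewrite // /pgroup cK0.
Qed.

Let KB g x : g \in K -> (g x \in B) = (x \in B).
Proof. by case/setIP=> _ /set_stabP. Qed.

Let KG g : g \in K -> g \in G.
Proof. by case/setIP. Qed.

Let O := orbit 'P K None.

Let OB : O \subset B.
Proof. by apply/subsetP=> _ /orbitP[g Kg <-]; rewrite /= apermE KB. Qed.

Let KO g x : g \in K -> (g x \in O) = (x \in O).
Proof. by move=> Kg; rewrite -(orbit_actr 'P%act None x Kg). Qed.

Let cK : #|K| = (#|O| * 4)%N.
Proof. by rewrite -cK0 card_orbit_stab. Qed.

Let ON : None \in O.
Proof. exact: orbit_refl. Qed.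

(** The four affine symmetries form a 2-group, whose nontrivial elements fix infinity
    only; all its other orbits are regular. *)
Lemma inf_orbit_mod4 : (4 %| #|O :\ None|)%N.
Proof.
rewrite -cK0; apply: (dvdn_semireg (to := 'P%act)).
  apply/subsetP=> t /K0P[Kt _ tN _]; apply/astabsP=> x.
  rewrite /= apermE !in_setD1 KO //; congr (~~ _ && _).
  by rewrite -{1}tN (inj_eq perm_inj).
move=> x /setD1P[xN _]; apply/trivgP/subsetP=> t /setIP[/K0P[_ Gt tN t2] /astab1P tx].
apply/set1P/eqP; apply: contraT => t1; case/eqP: xN.
exact: (two_elt_fix_uniq Gt t1 t2).
Qed.

(** Modulo 5, an element of order 5 would have [13 %% 5 = 3] fixed points in [B],
    while a nontrivial element of [G] has at most two. *)
Lemma inf_orbit_neq5 : #|O| != 5%N.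
Proof.
apply/eqP=> c5; have [|g Kg og] := Cauchy (isT : prime 5) (_ : 5 %| #|K|)%N.
  by rewrite cK c5.
have g1 : (g != 1)%g by rewrite -order_gt1 og.
have g5 : (5.-group <[g]>)%g by rewrite /pgroup -orderE og.
have := pgroup_fix_mod g5 (acts_cycle (fun x => KB x Kg)); rewrite cB.
by have := card_fix_PSL2 B (KG Kg) g1; case: #|_| => [|[|[|]]].
Qed.

(** The stabiliser, of order 36, would act faithfully on the four remaining points
    of [B], by sharp 3-transitivity; but there are only 24 permutations of them. *)
Lemma inf_orbit_neq9 : #|O| != 9%N.
Proof.
apply/eqP=> c9; have cW : #|B :\: O| = 4%N.
  by rewrite cardsD (setIidPr OB) cB c9.
pose W := B :\: O.
have KW g : g \in K -> g \in ('N(W | 'P))%g.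
  by move=> Kg; apply/astabsP=> x; rewrite /= apermE !in_setD KO ?KB.
have [x Wx] : exists x, x \in W by apply/card_gt0P; rewrite cW.
have cWx : #|W :\ x| = 3%N by move: cW; rewrite -/W (cardsD1 x) Wx add1n => -[].
have [y Wy] : exists y, y \in W :\ x by apply/card_gt0P; rewrite cWx.
have cWy : #|W :\ x :\ y| = 2%N by move: cWx; rewrite (cardsD1 y) Wy add1n => -[].
have [z /setD1P[zy /setD1P[zx Wz]]] : exists z, z \in W :\ x :\ y.
  by apply/card_gt0P; rewrite cWy.
have {Wy} /setD1P[yx Wy] := Wy.
have inj : {in K &, injective (restr_perm W)}.
  move=> g h Kg Kh e; apply/eqP; rewrite eq_mulVg1 eq_sym; apply/eqP.
  have gh t : t \in W -> (g^-1 * h)%g (g t) = g t.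
    move=> Wt; rewrite permM permK -(restr_permE (KW g Kg) Wt).
    by rewrite -(restr_permE (KW h Kh) Wt) e.
  symmetry; apply: (PSL2_fix3 (x := g x) (y := g y) (z := g z)); try exact: gh.
  - by rewrite groupM ?groupV ?KG.
  - by rewrite (inj_eq perm_inj) eq_sym.
  - by rewrite (inj_eq perm_inj) eq_sym.
  - by rewrite (inj_eq perm_inj) eq_sym.
have : (#|K| <= #|perm_on W|)%N.
  rewrite -(card_in_imset inj); apply/subset_leq_card/subsetP=> _ /imsetP[g Kg ->].
  exact: restr_perm_on.
by rewrite cK c9 card_perm cW.
Qed.

(** The stabiliser has order 52, so a Sylow subgroup [<[g]>] of order 13 is normal.
    An involution fixing infinity inverts [g] or centralises a nontrivial element
    of [<[g]>]. The latter element would fix the only fixed point of the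
    involution, infinity, and so have order dividing 4. So the three involutions
    fixing infinity all invert [g]; but one is the product of the other two and
    centralises [g]. *)
Lemma inf_orbit_neq13 : #|O| != 13%N.
Proof.
apply/eqP=> c13; have [|g Kg og] := Cauchy (isT : prime 13) (_ : 13 %| #|K|)%N.
  by rewrite cK c13.
have g1 : (g != 1)%g by rewrite -order_gt1 og.
have nP : (<[g]> <| K)%g.
  have sylP : (13.-Sylow(K) <[g]>)%g.
    rewrite pHallE cycle_subG Kg -orderE og cK c13 p_part.
    by rewrite (_ : logn 13 (13 * 4) = 1%N).
  have s1 : #|'Syl_13(K)|%g = 1%N.
    have := card_Syl_mod K (isT : prime 13); have := card_Syl_dvd 13 K.
    rewrite cK c13 dvdn_divisors // (_ : divisors _ = [:: 1; 2; 4; 13; 26; 52]%N) //.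
    by move: #|_| => s; rewrite !inE => /or4P[|||/or3P[]] /eqP-> // /eqP.
  have : #|K : 'N_K(<[g]>)|%g == 1%N by rewrite -(card_Syl sylP) s1.
  by rewrite indexg_eq1 subsetI => /andP[_ nKP]; rewrite /normal nKP cycle_subG Kg.
have gJ t : t \in K0 -> t != 1%g -> (g ^ t = g^-1)%g.
  move=> K0t t1; have [Kt Gt tN t2] := K0P K0t.
  have Pgt : (g ^ t)%g \in <[g]>%g.
    by rewrite memJ_norm ?cycle_id //; apply: (subsetP (normal_norm nP)).
  have cgt : commute g (g ^ t)%g by apply: (centsP (cycle_abelian g)); rewrite ?cycle_id.
  (* [y] is centralised by [t], and it is trivial only if [t] inverts [g]. *)
  pose y := (g * g ^ t)%g; have Py : y \in <[g]>%g by rewrite groupM ?cycle_id.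
  have yt : (y ^ t = y)%g.
    by rewrite conjMg -conjgM (two_elt_inf_inv Gt tN t2) conjg1 /y cgt.
  have Ky : y \in K by apply: subsetP Py; rewrite cycle_subG.
  suff y1 : y = 1%g by apply/eqP; rewrite eq_sym eq_invg_mul; apply/eqP.
  have yN : y None = None.
    apply: (two_elt_fix_uniq Gt t1 t2) => //.
    by rewrite -[in RHS]yt -{2}tN permJ.
  have d13 : (#[y]%g %| 13)%N by rewrite -og; apply: order_dvdG.
  have d4 : (#[y]%g %| 4)%N.
    by rewrite -cK0; apply: order_dvdG; apply/setIP; split=> //; apply/fix_infP.
  have : (#[y]%g %| gcdn 13 4)%N by rewrite dvdn_gcd d13 d4.
  by rewrite dvdn1 order_eq1 => /eqP.
have cK0n : #|K0 :\ 1%g| = 3%N by move: cK0; rewrite (cardsD1 1%g) group1 add1n => -[].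
have [t1 K0t1'] : exists t, t \in K0 :\ 1%g by apply/card_gt0P; rewrite cK0n.
have [t2 /setD1P[t21 /setD1P[t2n K0t2]]] : exists t, t \in K0 :\ 1%g :\ t1.
  by apply/card_gt0P; move: cK0n; rewrite (cardsD1 t1) K0t1' add1n => -[->].
have /setD1P[t1n K0t1] := K0t1'.
have t12 : (t1 * t2 != 1)%g.
  rewrite -eq_invg_mul; have [_ Gt1 t1N t1p] := K0P K0t1.
  have /eqP := two_elt_inf_inv Gt1 t1N t1p; rewrite -eq_invg_mul => /eqP->.
  by rewrite eq_sym.
have := gJ _ (groupM K0t1 K0t2) t12; rewrite conjgM gJ // conjVg gJ // invgK => /eqP.
rewrite eq_sym eq_invg_mul => /eqP e.
by have := order_dvdn g 2; rewrite og expgS expg1 e eqxx.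
Qed.

Lemma card_stab4 : #|K| = 4%N.
Proof.
have le13 : (#|O| <= 13)%N by rewrite -cB subset_leq_card.
have := inf_orbit_mod4; have := cardsD1 None O; rewrite ON add1n => e d.
move: cK inf_orbit_neq5 inf_orbit_neq9 inf_orbit_neq13 le13; rewrite e.
by case/dvdnP: d => k ->; case: k => [|[|[|[|]]]] // ->.
Qed.

End Stabiliser.

(** * Reduction to subsets of the affine line *)

Lemma preim_Some_setU1 (A : {set F}) : Some @^-1: (None |: Some @: A) = A.
Proof.
by apply/setP=> x; rewrite !inE /= mem_imset //; apply: Some_inj.
Qed.

Lemma card_None_setU1 (A : {set F}) : #|None |: Some @: A| = #|A|.+1.
Proof.
have Si : injective (@Some F) by move=> ? ? [].
rewrite cardsU1 card_imset //; case: imsetP => // -[x //].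
Qed.

(** The four symmetries form a 2-group, and affine maps of 2-power order are
    translations. *)
Lemma no_rotation_affine_stab4 (A : {set F}) : #|affine_stab A| = 4%N ->
  ~~ has_rotation A.
Proof.
move=> cA; rewrite /has_rotation negb_exists_in; apply/forall_inP=> -[a b] Sab /=.
apply/negPn/eqP; have /affine_stabP[a0 hab] := Sab.
have [g [Gg gN E]] := PSL2_affine b a0.
apply: (two_elt_translation Gg gN _ E).
pose B : {set X} := None |: Some @: A.
have cK0 : #|'C_('C_G[B | 'P^*])[None | 'P]%g| = 4%N.
  by rewrite card_inf_stab preim_Some_setU1.
apply: (mem_p_elt (G := 'C_('C_G[B | 'P^*])[None | 'P]%g)); first by rewrite /pgroup cK0.
apply/setIP; split; last exact/fix_infP.
apply/setIP; split=> //; apply/set_stabP=> -[x|]; last by rewrite gN.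
have PB z : (Some z \in B) = (z \in A).
  by have /setP/(_ z) := preim_Some_setU1 A; rewrite inE.
by rewrite E !PB hab.
Qed.

Lemma affine_stab_eq4 (A : {set F}) :
  (#|affine_stab A| == 4%N) = (#|shift_stab A| == 4%N) && ~~ has_rotation A.
Proof.
apply/eqP/andP => [cS|[/eqP cT nrot]]; last by rewrite card_affine_stab_norot.
have nrot := no_rotation_affine_stab4 cS.
by rewrite -card_affine_stab_norot // cS.
Qed.

Lemma card_stab4_inf :
  #|[set B in stab4_sets | 'C_G[B | 'P^*]%g \subset 'C[None | 'P]%g]|
  = #|[set A : {set F} | (#|A| == 12) && (#|affine_stab A| == 4)]|.
Proof.
pose f (A : {set F}) : {set X} := None |: Some @: A.
have fK : cancel f (fun B => Some @^-1: B) by move=> A; apply: preim_Some_setU1.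
rewrite -[RHS](card_imset _ (can_inj fK)); apply: eq_card => B.
rewrite in_set; apply/andP/imsetP => [[]|[A]].
  rewrite in_set => /andP[/eqP cB /eqP cK] sK.
  have K1 : 'C_G[B | 'P^*]%g != 1%g by rewrite -cardG_gt1 cK.
  have K2 : (2.-group 'C_G[B | 'P^*])%g by rewrite /pgroup cK.
  have actB : [acts 'C_G[B | 'P^*], on B | 'P]%g.
    by rewrite -astab1_set subsetIr.
  have oB : odd #|B| by rewrite cB.
  have /eqP/cards1P[y fy] := two_group_fix1 (subsetIl _ _) K1 K2 oB actB.
  have /setIP[By /afixP fixy] : y \in 'Fix_(B | 'P)('C_G[B | 'P^*])%g by rewrite fy set11.
  have yN : None = y.
    apply: (two_group_fix_uniq (subsetIl _ _) K1 K2) => [g Kg|g /fixy //].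
    by apply/fix_infP; apply: (subsetP sK).
  have Bf : B = f (Some @^-1: B).
    apply/setP=> -[x|]; rewrite !inE /=; last by rewrite yN By.
    by rewrite mem_imset ?inE //; apply: Some_inj.
  exists (Some @^-1: B) => //; rewrite in_set -card_inf_stab (setIidPl sK) cK.
  by rewrite -eqSS -card_None_setU1 -/(f _) -Bf cB.
rewrite in_set => /andP[/eqP cA /eqP sA] ->.
have cB : #|f A| = 13%N by rewrite card_None_setU1 cA.
have cK0 : #|'C_('C_G[f A | 'P^*])[None | 'P]%g| = 4%N.
  by rewrite card_inf_stab preim_Some_setU1.
have cK : #|'C_G[f A | 'P^*]%g| = 4%N by apply: card_stab4 => //; rewrite setU11.
split; first by rewrite in_set cB cK.
have /eqP <- : 'C_('C_G[f A | 'P^*])[None | 'P]%g == 'C_G[f A | 'P^*]%g.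
  by rewrite eqEcard subsetIl cK0 cK.
exact: subsetIr.
Qed.

(** The stabiliser of each such set fixes exactly one point, and by transitivity
    all points occur equally often. *)
Lemma card_stab4_sets :
  #|stab4_sets| = (#|F|.+1 *
    #|[set A : {set F} | (#|A| == 12) && (#|affine_stab A| == 4)]|)%N.
Proof.
rewrite -card_stab4_inf -sum1_card.
pose N (p : X) := [set B in stab4_sets | 'C_G[B | 'P^*]%g \subset 'C[p | 'P]%g].
transitivity (\sum_(B in stab4_sets) \sum_(p | 'C_G[B | 'P^*]%g \subset 'C[p | 'P]%g) 1)%N.
  apply: eq_bigr => B; rewrite in_set => /andP[_ /eqP cK].
  have K1 : 'C_G[B | 'P^*]%g != 1%g by rewrite -cardG_gt1 cK.
  have K2 : (2.-group 'C_G[B | 'P^*])%g by rewrite /pgroup cK.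
  have oX : odd #|[set: X]| by rewrite cardsT card_option.
  have actX : [acts 'C_G[B | 'P^*], on [set: X] | 'P]%g.
    by apply/subsetP=> g _; apply/astabsP=> t; rewrite !inE.
  rewrite sum1dep_card -[LHS](two_group_fix1 (subsetIl _ _) K1 K2 oX actX).
  apply: eq_card => p; rewrite setTI in_set; apply/afixP/subsetP => h g Kg.
    by apply/astab1P/h.
  exact/astab1P/h.
rewrite (exchange_big_dep predT) //= -card_option -sum_nat_const.
apply: eq_big => // p _; rewrite sum1dep_card.
have [h Gh hp] := PSL2_to_inf p.
rewrite -[LHS](card_imset _ (act_inj 'P^* h)); apply: eq_card => B; rewrite [RHS]in_set.
have pE : ('C[None | 'P] = 'C[p | 'P] :^ h)%g by rewrite -hp -astab1_act.
apply/imsetP/andP => [[B' + ->]|[S4 sB]].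
  by rewrite in_set stab4_sets_act // set_stab_act // pE conjSg => /andP[].
exists (('P^*)%act B (h^-1)%g); last by rewrite actKV.
by rewrite in_set stab4_sets_act ?groupV // S4 set_stab_act ?groupV // sub_conjgV -pE.
Qed.

Lemma m429_affine :
  (m F 429 * (#|F|.-1 * #|F|)
    = 4 * #|[set A : {set F} | (#|A| == 12) && (#|affine_stab A| == 4)]|)%N.
Proof.
have := m429E; rewrite card_stab4_sets card_PSL2 => e.
by apply/eqP; rewrite -(eqn_pmul2l (ltn0Sn #|F|)) mulnCA e (mulnCA 4%N).
Qed.

End ProjectiveLine.

(** * The count *)

Theorem proposition5p19 (n : nat) (F : finFieldType)
    (n_ge1 : (1 <= n)%N) (cardF : #|F| = (2 ^ n)%N) :
  (m F 429)%:R =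
    (if odd n
     then (2 ^+ n - 2) * (2 ^+ n - 4) * (2 ^+ n - 8) / 576
     else 2 ^+ n * (2 ^+ n - 4) * (2 ^+ n - 10) / 576) :> rat.
Proof.
have char2 : 2%N \in [pchar F] := card_finPcharP cardF isT.
have ev : ~~ odd #|F| by rewrite cardF oddX negb_or -lt0n n_ge1.
pose q : rat := 2 ^+ n.
have q_ge2 : (2 <= 2 ^ n)%N by rewrite -{1}(expn1 2) leq_exp2l.
have qE : (2 ^ n)%:R = q by rewrite natrX.
have q1E : ((2 ^ n).-1)%:R = q - 1 by rewrite -subn1 natrB ?qE // ltnW.
have q2E : ((2 ^ n).-2)%:R = q - 2 by rewrite -subn2 natrB ?qE.
have q0 : q != 0 by rewrite expf_neq0.
have q10 : q - 1 != 0 by rewrite -q1E Num.Theory.pnatr_eq0 -subn1 subn_eq0 -ltnNge.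
pose T1 := #|[set A : {set F} | (#|A| == 12) && (#|shift_stab A| == 4)]|.
pose T2 := #|[set A : {set F} | [&& #|A| == 12, #|shift_stab A| == 4 & has_rotation A]]|.
(* 2304 is [6 * 6 * 4 ^ 3]: a four-group has 6 generating pairs, ['C(k, 3)] has
   denominator [3`! = 6], and [k = q / 4] enters it three times. *)
have T1E : T1%:R = (q - 1) * (q - 2) * (q * (q - 4) * (q - 8)) / 2304 :> rat.
  have /(congr1 (fun i => i%:R : rat)) := count_shift_stab4 char2 cardF.
  rewrite -/T1 cardF !natrM q1E q2E natr_bin3 => e.
  have n6 : 6 != 0 :> rat by [].
  apply: (mulfI n6); rewrite e.
  have [n2|n2] := leqP 2 n.
    have kE : (2 ^ n %/ 4)%:R = q / 4 :> rat.
      rewrite -[n in LHS](subnK n2) expnD mulnK // natrX /q -[n in RHS](subnK n2).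
      by rewrite exprD mulfK.
    by rewrite kE; field.
  (* For [q = 2] the quotient [q / 4] is truncated, but [q - 2] vanishes. *)
  have n1 : n = 1%N by apply/eqP; rewrite eqn_leq n_ge1 -ltnS n2.
  have -> : q - 2 = 0 by rewrite /q n1 expr1 subrr.
  by rewrite !(mulr0, mul0r).
have T2E : T2%:R = if odd n then 0 else q * (q - 1) * (q - 4) / 144 :> rat.
  case: ifPn => on.
    rewrite /T2 (_ : [set A | _] = set0) ?cards0 //; apply/setP=> A.
    rewrite in_set in_set0; apply/and3P=> -[_ /eqP cT rot].
    by have := odd_no_rotation char2 cardF on cT; rewrite rot.
  have [w w_root] := cube_root_exists cardF on n_ge1.
  have /(congr1 (fun i => i%:R : rat)) := count_rotation char2 w_root cardF.
  have q_ge4 : (4 <= 2 ^ n)%N.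
    rewrite (_ : 4 = 2 ^ 2)%N // leq_exp2l //.
    by case: (n) on n_ge1 => [|[|]].
  rewrite -/T2 cardF !natrM q1E (natrB _ q_ge4) qE => e.
  have n144 : 144 != 0 :> rat by [].
  by apply: (mulfI n144); rewrite e; field.
have TE : (#|[set A : {set F} | (#|A| == 12) && (#|affine_stab A| == 4)]| + T2 = T1)%N.
  rewrite addnC /T1 -[RHS](cardsID [set A | has_rotation A]); congr (_ + _)%N.
    by apply: eq_card => A; rewrite in_setI !in_set andbA.
  apply: eq_card => A; rewrite in_setD !in_set (affine_stab_eq4 ev char2).
  by rewrite andbA andbC.
have /(congr1 (fun i => i%:R : rat)) := m429_affine ev char2.
rewrite cardF !natrM q1E qE => e.
have Le : (m F 429)%:R = 4 * (T1%:R - T2%:R) / ((q - 1) * q).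
  apply: (canRL (mulfK _)); first by rewrite mulf_neq0.
  by rewrite e -TE natrD addrK.
by rewrite Le T1E T2E -/q; case: ifP => _; field; rewrite q0 q10.
Qed.
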